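(* For every admissible index $\boldsymbol{k}$ and every integer $m\ge 0$, $$\sum_{\substack{\mathrm{wt}(\boldsymbol{e})=m\\ \mathrm{dep}(\boldsymbol{e})=\mathrm{dep}(\boldsymbol{k})}} c_1(\boldsymbol{k},\boldsymbol{e})\,\zeta^\star(\boldsymbol{k}\oplus\boldsymbol{e})=\sum_{\substack{\mathrm{wt}(\boldsymbol{e})=m\\ \mathrm{dep}(\boldsymbol{e})=\mathrm{dep}(\boldsymbol{k}^\dagger)}}\zeta^\star\bigl((\boldsymbol{k}^\dagger\oplus\boldsymbol{e})^\dagger\bigr),$$ where in both sums $\boldsymbol{e}$ runs over sequences of nonnegative integers, and $$c_1((k_1,\ldots,k_r),(e_1,\ldots,e_r))=\prod_{i=1}^{r}\binom{k_i+e_i+\delta_{i,1}-2}{e_i},$$ with the convention that $\binom{n-1}{n}=1$ if $n=0$ and $\binom{n-1}{n}=0$ otherwise ($n\ge 0$).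
   Context: An index is a (possibly empty) finite sequence of positive integers. An index is admissible if it is empty or its last component is greater than $1$. For a finite sequence $\boldsymbol{k}=(k_1,\ldots,k_r)$ of nonnegative integers, $\mathrm{wt}(\boldsymbol{k})=k_1+\cdots+k_r$ (weight) and $\mathrm{dep}(\boldsymbol{k})=r$ (depth). For two sequences of the same depth, $\boldsymbol{k}\oplus\boldsymbol{l}$ is their componentwise sum. $\delta_{i,j}$ is the Kronecker delta. $\{1\}^m$ denotes $1,\ldots,1$ ($m$ times). For an admissible index $(k_1,\ldots,k_r)$, the multiple zeta-star value is the real number $$\zeta^\star(k_1,\ldots,k_r)=\sum_{1\le n_1\le\cdots\le n_r}\frac{1}{n_1^{k_1}\cdots n_r^{k_r}},$$ and $\zeta^\star(\emptyset)=1$. Dual index: every admissible index can be written uniquely as $\boldsymbol{k}=(\{1\}^{a_1-1},b_1+1,\ldots,\{1\}^{a_s-1},b_s+1)$ with $s\ge0$ and integers $a_p,b_q\ge1$; its dual index is $\boldsymbol{k}^\dagger=(\{1\}^{b_s-1},a_s+1,\ldots,\{1\}^{b_1-1},a_1+1)$ (so $\emptyset^\dagger=\emptyset$). *)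

(* Defs.v *)
From mathcomp Require Import all_boot all_order all_algebra.
From mathcomp Require Import all_classical all_reals all_analysis.
Set Implicit Arguments.
Unset Strict Implicit.
Unset Printing Implicit Defensive.
Import Order.TTheory GRing.Theory Num.Theory.

Definition is_index (k : seq nat) : bool := all (fun x => 0 < x) k.

(* [last 2 k] is 2 on the empty sequence, so the empty index is admissible. *)
Definition admissible (k : seq nat) : bool := is_index k && (1 < last 2 k).

Definition wt (k : seq nat) : nat := sumn k.

Definition dep (k : seq nat) : nat := size k.

Definition oplus (k l : seq nat) : seq nat := [seq p.1 + p.2 | p <- zip k l].

(* ({1}^(a_1-1), b_1+1, ..., {1}^(a_s-1), b_s+1) for the list of the pairs
   (a_p, b_p). *)
Definition of_blocks (s : seq (nat * nat)) : seq nat :=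
  flatten [seq rcons (nseq p.1.-1 1) p.2.+1 | p <- s].

(* Reads off the pairs (a_p, b_p); [a] is one plus the number of 1s met since
   the end of the last complete block. *)
Fixpoint blocks_rec (a : nat) (k : seq nat) : seq (nat * nat) :=
  match k with
  | [::] => [::]
  | x :: k' =>
      if x == 1 then blocks_rec a.+1 k' else (a, x.-1) :: blocks_rec 1 k'
  end.

Definition blocks (k : seq nat) : seq (nat * nat) := blocks_rec 1 k.

Definition dual_index (k : seq nat) : seq nat :=
  of_blocks (rev [seq (p.2, p.1) | p <- blocks k]).

(* The next three facts say that [blocks k] is the unique decomposition of an
   admissible index [k] into blocks with a_p, b_p >= 1. *)
Lemma blocks_pos k : is_index k ->
  all (fun p => (0 < p.1) && (0 < p.2)) (blocks k).
Proof.
suff H a : 0 < a -> is_index k ->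
    all (fun p => (0 < p.1) && (0 < p.2)) (blocks_rec a k) by exact: H.
elim: k a => //= x k IH a a0 /andP[x0 kP].
case: eqP => [_|/eqP x1]; first exact: IH.
by rewrite /= a0 IH // andbT; case: x x0 x1 => [|[]].
Qed.

Lemma blocksK k : admissible k -> of_blocks (blocks k) = k.
Proof.
suff H a : admissible k ->
    of_blocks (blocks_rec a.+1 k) = if k is [::] then [::] else nseq a 1 ++ k.
  by move=> /H; rewrite /blocks => ->; case: (k).
rewrite /admissible; elim: k a => [//|x k IH] a /= /andP[/andP[x0 kP] lk].
case: eqP => [x1|/eqP x1].
  subst x; case: k kP lk IH => [//|y k] kP lk IH.
  rewrite IH; last by rewrite kP.
  by elim: a => //= a [->].
have x_gt1 : 1 < x by case: x x0 x1 {lk} => [|[]].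
rewrite /of_blocks /= -/(of_blocks _) IH; last first.
  by rewrite kP; case: (k) lk.
by rewrite prednK // cat_rcons; case: (k).
Qed.

Lemma of_blocksK s : all (fun p => (0 < p.1) && (0 < p.2)) s ->
  admissible (of_blocks s) /\ blocks (of_blocks s) = s.
Proof.
move=> sP; split; last first.
  elim: s sP => [//|[a b] s IH] /= /andP[/andP[/= a0 b0] /IH bs].
  rewrite /of_blocks /= -/(of_blocks s) /blocks cat_rcons.
  have H n c l : blocks_rec c (nseq n 1 ++ l) = blocks_rec (n + c) l.
    by elim: n c => //= n IHn c; rewrite IHn addSnnS.
  rewrite H addn1 prednK //=.
  by case: b b0 => //= b _; rewrite [blocks_rec _ _]bs.
rewrite /admissible; elim: s sP => [//|[a b] s IH] /= /andP[/andP[/= a0 b0] /IH].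
rewrite /of_blocks /= -/(of_blocks s) => /andP[sI sl].
rewrite /is_index all_cat all_rcons /= all_nseq orbT /= [all _ _]sI /=.
rewrite last_cat last_rcons.
by case: (of_blocks s) sl.
Qed.

(* Binomial coefficients are natural numbers and subtraction is truncated. For
   k_i >= 1 truncation only occurs when k_i = 1, e_i = 0 and i is not the first
   position: then 'C(0, 0) = 1 stands for binom(-1, 0), which is 1 by convention.
   Positions are numbered from 0. *)
Definition c1 (k e : seq nat) : nat :=
  \prod_(i < dep k)
    'C(nth 0 k i + nth 0 e i + (i == 0 :> nat) - 2, nth 0 e i).

Local Open Scope ring_scope.
Local Open Scope classical_set_scope.

(* The sum is taken in [\bar R] over the unordered family of all weakly
   increasing sequences of positive integers of length dep k; it is finite when
   [k] is admissible. *)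
Definition zeta_star (R : realType) (k : seq nat) : R :=
  fine (\esum_(n in [set n : seq nat |
                 [&& size n == dep k, all (fun x => (0 < x)%N) n
                   & sorted leq n]])
          (\prod_(i < dep k) ((nth 0%N n i)%:R ^+ nth 0%N k i)^-1)%:E).

(* Main.v *)
Require Import Defs.
From mathcomp Require Import all_boot all_order all_algebra.
From mathcomp Require Import all_classical all_reals all_analysis.
From mathcomp Require Import zify ring lra.

(** Both sides are coefficients of x^m in generating functions which are built
    letter by letter from two operators on real sequences a(1), a(2), ...:
    division [D a (n) = a(n) / n] and the Cesaro mean
    [A a (n) = (a(1) + ... + a(n)) / n].  The summand of the zeta-star value of
    (k_1, ..., k_r), as a function of the largest summation variable, is
    [D^(k_r - 1) A ... D^(k_1 - 1) A] applied to the unit mass, and the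
    zeta-star value is its total sum ([zeta_star_series]).

    Summing the left-hand side against x^m turns D into
    [D_x a (n) = a(n) / (n - x)], because the binomial coefficients of c_1 are
    those of (1 - x / n)^(-p).  On the right-hand side, passing to the dual
    index exchanges the roles of D and A ([foldr_rev_dual]), so that increasing
    the entries of the dual index inserts powers of A in front of the letters D
    of the original word: the sum against x^m turns D into [D (1 - x A)^-1].

    The two generating functions are related by an explicit lower triangular
    operator T.  If (x)_n is the rising factorial, let
      [T a (n) = 1/n * sum_(j <= n) ((1-x)_j / j!) ((x)_(n-j) / (n-j)!) j a(j)].
    Then [T A = A T] ([transfer_cesaro]) and [T D_x = D (1 - x A)^-1 T]
    ([transfer_resolvent]), and the initial sequences correspond
    ([transfer_shift_one]); hence T maps the summand of the left generating
    function to that of the right one ([generates_left_family],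
    [generates_right_family]).  Moreover the weights of T are those of
    beta-binomial probability distributions, up to the factor j/n, and this
    makes the partial sums of T a weighted averages of the partial sums of a
    ([beta_binomial_psum]).  Thus T preserves convergent sums
    ([psum_transfer_cvg]), the two generating functions agree for
    0 < x <= 1/2, and so do their coefficients ([nneseries_pow_eq]). *)

Set Implicit Arguments.
Unset Strict Implicit.
Unset Printing Implicit Defensive.
Import Order.TTheory GRing.Theory Num.Theory.
Import numFieldNormedType.Exports.
Local Open Scope classical_set_scope.
Local Open Scope ring_scope.

(** * Cesaro means and the beta-binomial transfer operator *)

Section Operators.
Variable R : realFieldType.
Implicit Types (x : R) (a b : nat -> R).

(** Index 0 is kept so that sums run over an ordinal; it is harmless because
    [0^-1 = 0] makes [ndiv], [cesaro_mean] and [transfer] vanish there. *)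
Definition psum a n : R := \sum_(j < n.+1) a j.
Definition ndiv a n : R := n%:R^-1 * a n.
Definition cesaro_mean a n : R := n%:R^-1 * psum a n.

Lemma psumS a n : psum a n.+1 = psum a n + a n.+1.
Proof. by rewrite /psum big_ord_recr. Qed.

Lemma psum0 a : psum a 0 = a 0.
Proof. exact: big_ord1. Qed.

Lemma natS_neq0 n : n.+1%:R != 0 :> R.
Proof. by rewrite pnatr_eq0. Qed.

(** The coefficient of t^n in (1 - t)^(-x), that is (x)_n / n!. *)
Definition rising_fact x n : R := \prod_(i < n) ((i%:R + x) / i.+1%:R).

Lemma rising_fact0 x : rising_fact x 0 = 1.
Proof. by rewrite /rising_fact big_ord0. Qed.

Lemma rising_factS x n :
  n.+1%:R * rising_fact x n.+1 = (n%:R + x) * rising_fact x n.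
Proof.
rewrite /rising_fact big_ord_recr /= mulrCA -[n.+1%:R * _]mulrC.
by rewrite (divfK (natS_neq0 n)) mulrC.
Qed.

Lemma rising_fact_ge0 x n : 0 <= x -> 0 <= rising_fact x n.
Proof.
move=> x0; apply: prodr_ge0 => i _.
by rewrite divr_ge0 ?addr_ge0.
Qed.

(** Coefficientwise form of the fact that (1 - t)^(-x) / (1 - t) is
    (1 - t)^(-(x+1)), whose n-th coefficient is (n + x) / x times that of
    (1 - t)^(-x). *)
Lemma psum_rising_fact x n :
  x * psum (rising_fact x) n = (n%:R + x) * rising_fact x n.
Proof.
elim: n => [|n IH]; first by rewrite psum0 rising_fact0 add0r.
rewrite psumS mulrDr IH -rising_factS -mulrDl; congr (_ * _); ring.
Qed.

(** The expectation of b under the beta-binomial distribution on 0, ..., n with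
    parameters 1 - x and x. *)
Definition beta_binomial x b n : R :=
  \sum_(j < n.+1) rising_fact (1 - x) j * rising_fact x (n - j) * b j.

Lemma beta_binomial0 x b : beta_binomial x b 0 = b 0.
Proof.
by rewrite /beta_binomial big_ord1 /= !rising_fact0 !mul1r.
Qed.

Lemma eq_beta_binomial x b b' n : (forall j, (j <= n)%N -> b j = b' j) ->
  beta_binomial x b n = beta_binomial x b' n.
Proof. by move=> e; apply: eq_bigr => j _; rewrite e // -ltnS. Qed.

(** Summation by parts: the coefficients [g_j = j u_j v_(n+1-j)], with u_j and
    v_j those of (1 - t)^(x-1) and (1 - t)^(-x), satisfy
    [g_j - g_(j+1) = (n+1) u_j (v_(n+1-j) - v_(n-j))]. *)
Lemma beta_binomial_diff x b n :
  n.+1%:R * (beta_binomial x b n.+1 - beta_binomial x b n) =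
  beta_binomial x (fun j => j%:R * (b j - b j.-1)) n.+1.
Proof.
rewrite /beta_binomial.
set u := rising_fact (1 - x); set v := rising_fact x.
transitivity
  (\sum_(j < n.+2) u j * v (n.+1 - j)%N * (j%:R * b j)
   - \sum_(j < n.+1) u j.+1 * v (n - j)%N * (j.+1%:R * b j)); last first.
  rewrite [X in _ - X](_ : _ =
      \sum_(j < n.+2) u j * v (n.+1 - j)%N * (j%:R * b j.-1)); last first.
    rewrite [RHS]big_ord_recl /= mul0r mulr0 add0r.
    by apply: eq_bigr => j _; rewrite /bump /= add1n subSS.
  by rewrite -sumrB; apply: eq_bigr => j _; rewrite -mulrBr -mulrBr.
rewrite big_ord_recr [in RHS]big_ord_recr /= subnn addrAC mulrDr [RHS]addrAC.
congr (_ + _); last by rewrite mulrCA.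
rewrite -!sumrB mulr_sumr.
apply: eq_bigr => -[j /= jn] _.
have -> : n = (n - j + j)%N by rewrite subnK.
move: (n - j)%N => i {jn}.
rewrite -addSn !addnK.
have hu : j.+1%:R * u j.+1 = (j%:R + (1 - x)) * u j := rising_factS _ _.
have hv : i.+1%:R * v i.+1 = (i%:R + x) * v i := rising_factS _ _.
rewrite [u j.+1 * _ * _](_ : _ = (j.+1%:R * u j.+1) * v i * b j); last by ring.
rewrite hu addSn -addnS natrD.
have -> : (i%:R + j.+1%:R) * (u j * v i.+1 * b j - u j * v i * b j) =
  (i.+1%:R * v i.+1) * u j * b j + j%:R * u j * v i.+1 * b j
  - (i%:R + j.+1%:R) * u j * v i * b j by ring.
rewrite hv; ring.
Qed.

(** The weights sum to 1: by the difference formula the expectation of a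
    constant does not depend on n. *)
Lemma beta_binomial1 x n : beta_binomial x (fun=> 1) n = 1.
Proof.
elim: n => [|n IH]; first exact: beta_binomial0.
apply/eqP; rewrite -subr_eq0 -[in X in _ - X]IH.
rewrite -(mulrI_eq0 _ (mulfI (natS_neq0 n))) beta_binomial_diff.
by rewrite /beta_binomial big1 // => j _; rewrite subrr !mulr0.
Qed.

(** The operator T, which carries the left-hand generating function to the
    right-hand one. *)
Definition transfer x a n : R := n%:R^-1 * beta_binomial x (fun j => j%:R * a j) n.

Lemma transfer0 x a : transfer x a 0 = 0.
Proof. by rewrite /transfer invr0 mul0r. Qed.

(** Both sides have the same increments, by [beta_binomial_diff].  This exhibits
    the partial sums of [transfer x a] as averages of those of [a]. *)
Lemma beta_binomial_psum x a n : a 0 = 0 ->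
  beta_binomial x (psum a) n = psum (transfer x a) n.
Proof.
move=> a0; elim: n => [|n IH].
  by rewrite beta_binomial0 !psum0 transfer0.
rewrite psumS -IH; apply/eqP; rewrite addrC -subr_eq; apply/eqP.
apply: (mulfI (natS_neq0 n)); rewrite beta_binomial_diff mulVKf ?natS_neq0 //.
apply: eq_beta_binomial => -[|j] _; first by rewrite !mul0r.
by rewrite psumS addrC addKr.
Qed.

Lemma transfer_cesaro x a : a 0 = 0 ->
  transfer x (cesaro_mean a) =1 cesaro_mean (transfer x a).
Proof.
move=> a0 n; rewrite /cesaro_mean -beta_binomial_psum //.
congr (_ * _); apply: eq_beta_binomial => -[|j] _.
  by rewrite mul0r psum0.
by rewrite mulVKf ?natS_neq0.
Qed.

(** For n > 0 this is [a n / (n - x)]; the form chosen here vanishes at 0. *)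
Definition shift_div x a n : R := (n%:R^-1 * a n) / (1 - x / n%:R).

Lemma psum_triangle (f : nat -> nat -> R) n :
  psum (fun m => \sum_(j < m.+1) f m j) n =
  \sum_(j < n.+1) psum (fun i => f (i + j)%N j) (n - j).
Proof.
elim: n => [|n IH]; first by rewrite psum0 !big_ord1 psum0.
rewrite psumS IH [RHS]big_ord_recr /= subnn psum0.
rewrite [X in _ + X = _]big_ord_recr /= addrA add0n.
congr (_ + _); rewrite -big_split; apply: eq_bigr => -[j /= jn] _.
by rewrite subSn // psumS addSn subnK.
Qed.

(** The weight of b_j, the product of u_j and v_i with i = n - j, is multiplied
    on the left by [n - (i + x) = j - x], in view of [psum_rising_fact]. *)
Lemma beta_binomial_shift x b n :
  n%:R * beta_binomial x b n - x * psum (beta_binomial x b) n =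
  beta_binomial x (fun j => (j%:R - x) * b j) n.
Proof.
rewrite (psum_triangle (fun m j => rising_fact (1 - x) j * rising_fact x (m - j) * b j)).
rewrite /beta_binomial !mulr_sumr -sumrB.
apply: eq_bigr => -[j /= jn] _.
have -> : psum (fun i => rising_fact (1 - x) j * rising_fact x (i + j - j)
    * b j) (n - j) =
  rising_fact (1 - x) j * b j * psum (rising_fact x) (n - j).
  rewrite /psum mulr_sumr; apply: eq_bigr => i _.
  by rewrite addnK mulrAC.
rewrite [X in _ - X]mulrCA psum_rising_fact.
have -> : n%:R = (n - j)%:R + j%:R :> R by rewrite -natrD subnK.
ring.
Qed.

Lemma ndivK_transfer x a : ndiv (fun m => m%:R * transfer x a m) =1 transfer x a.
Proof.
case=> [|n]; first by rewrite transfer0 /ndiv invr0 mul0r.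
by rewrite /ndiv mulKf ?natS_neq0.
Qed.

(** Since [n * transfer x c n] is an average of [j * c j], this is
    [(1 - x A) N T D_x = T] with N the multiplication by n; composing with
    [D (1 - x A)^-1] gives the commutation of T with the letter D. *)
Lemma transfer_resolvent x a n : (forall j, (0 < j)%N -> j%:R != x) ->
  n%:R * transfer x (shift_div x a) n =
  transfer x a n +
  x * cesaro_mean (fun m => m%:R * transfer x (shift_div x a) m) n.
Proof.
move=> jx; set b := fun j => j%:R * shift_div x a j.
have NT m : m%:R * transfer x (shift_div x a) m = beta_binomial x b m.
  case: m => [|m]; first by rewrite mul0r beta_binomial0 /b mul0r.
  by rewrite /transfer mulVKf ?natS_neq0.
rewrite /cesaro_mean NT (_ : psum _ n = psum (beta_binomial x b) n); last first.
  by apply: eq_bigr => i _; rewrite NT.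
case: n => [|n]; first by rewrite beta_binomial0 transfer0 invr0 /b; ring.
have e : beta_binomial x (fun j => j%:R * a j) n.+1 =
    beta_binomial x (fun j => (j%:R - x) * b j) n.+1.
  apply: eq_beta_binomial => -[|j] _; first by rewrite /b !mul0r mulr0.
  have j0 := natS_neq0 j; have jx0 : j.+1%:R - x != 0 by rewrite subr_eq0 jx.
  rewrite /b /shift_div; move: j.+1%:R j0 jx0 (a j.+1) => y j0 jx0 c.
  by field; rewrite j0 jx0.
rewrite /transfer e -beta_binomial_shift; have := natS_neq0 n.
by move: n.+1%:R => y y0; field.
Qed.

(** The factor j / (j - x) turns (1-x)_j / j! into (1-x)_(j-1) / (j-1)!, so
    that the sum is the total mass of the distribution on 0, ..., n-1. *)
Lemma transfer_shift_one x n : (forall j, (0 < j)%N -> j%:R != x) ->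
  transfer x (shift_div x (fun=> 1)) n = n%:R^-1.
Proof.
move=> jx; case: n => [|n]; first by rewrite transfer0 invr0.
rewrite /transfer -[RHS]mulr1; congr (_ * _); rewrite -[RHS](beta_binomial1 x n).
rewrite /beta_binomial big_ord_recl /= mul0r mulr0 add0r.
apply: eq_bigr => j _; rewrite /bump /= add1n subSS mulr1.
have j0 := natS_neq0 j; have jx0 : j.+1%:R - x != 0 by rewrite subr_eq0 jx.
have hu := rising_factS (1 - x) j.
have e : rising_fact (1 - x) j =
    j.+1%:R * rising_fact (1 - x) j.+1 / (j.+1%:R - x).
  by rewrite hu -natr1 addrA [_ + 1 - x]addrAC; field; rewrite addrAC natr1.
rewrite e /shift_div; move: j.+1%:R j0 jx0 => y j0 jx0.
by field; rewrite j0 jx0.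
Qed.
End Operators.

(** * Convergence and growth estimates *)

Section Estimates.
Variable R : realType.
Implicit Types (x : R) (a b : nat -> R).

(** An elementary substitute for the asymptotics n^(x-1) / Gamma(x), sufficient
    for x <= 1/2: the induction step is (n+2) (n+1/2)^2 <= (n+1)^3. *)
Lemma rising_fact_sqr x n : 0 <= x <= 2^-1 ->
  n.+1%:R * rising_fact x n ^+ 2 <= 1.
Proof.
move=> /andP[x0 x2]; elim: n => [|n IH].
  by rewrite rising_fact0 expr1n mulr1.
apply: le_trans IH; set r := rising_fact x n.
have -> : rising_fact x n.+1 = (n%:R + x) * r / n.+1%:R.
  by rewrite -rising_factS mulrAC mulfV ?natS_neq0 // mul1r.
rewrite expr_div_n exprMn mulrA mulrA ler_pdivrMr ?exprn_gt0 ?ltr0Sn //.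
rewrite [leRHS]mulrAC ler_wpM2r ?sqr_ge0 //.
have : 0 <= n%:R :> R by [].
rewrite -[n.+2%:R]natr1 -[n.+1%:R]natr1; move: n%:R => y y0.
have h : (y + x) ^+ 2 <= (y + 2^-1) ^+ 2 by rewrite ler_sqr ?nnegrE; lra.
by apply: (le_trans (ler_wpM2l _ h)); nra.
Qed.

Lemma rising_fact_cvg0 x : 0 <= x <= 2^-1 -> rising_fact x @ \oo --> 0.
Proof.
move=> xI; have x0 : 0 <= x by case/andP: xI.
rewrite (_ : rising_fact x = fun n => Num.sqrt (rising_fact x n ^+ 2)); last first.
  by apply/funext => n; rewrite sqrtr_sqr ger0_norm // rising_fact_ge0.
rewrite -[0 : R]sqrtr0; apply: continuous_cvg; first exact: sqrt_continuous.
apply: (@squeeze_cvgr _ _ _ _ (fun=> 0) (@harmonic R)).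
- near=> n; rewrite sqr_ge0 /= -[leRHS]mul1r ler_pdivlMr ?ltr0Sn //.
  by rewrite mulrC rising_fact_sqr.
- exact: cvg_cst.
- exact: cvg_harmonic.
Unshelve. all: by end_near. Qed.

(** The sequence (x)_n / n! is not summable, but this comparison with its
    decrements makes its quotient by n summable. *)
Lemma rising_fact_decr x n : 0 <= x <= 2^-1 ->
  rising_fact x n.+1 / n.+1%:R <= 2 * (rising_fact x n - rising_fact x n.+1).
Proof.
move=> /andP[x0 x2]; have := rising_factS x n.
have := rising_fact_ge0 n x0; have := rising_fact_ge0 n.+1 x0.
move: (rising_fact x n) (rising_fact x n.+1) => r r' r'0 r0.
have n0 : 0 <= n%:R :> R by [].
rewrite ler_pdivrMr ?ltr0Sn // -natr1; move: n%:R n0 => y y0 e.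
have rr' : r' <= r by rewrite -(ler_pM2l (_ : 0 < y + 1)) ?ltr_wpDl // e ler_wpM2r //; lra.
have -> : 2 * (r - r') * (y + 1) = 2 * ((1 - x) * r).
  have -> : 2 * (r - r') * (y + 1) = 2 * (r * (y + 1) - (y + 1) * r') by ring.
  by rewrite e; ring.
by nra.
Qed.

Lemma rising_fact_lbound x n : 0 <= x -> x <= n.+1%:R * rising_fact x n.+1.
Proof.
move=> x0; rewrite rising_factS -psum_rising_fact.
rewrite ler_peMr // /psum big_ord_recl rising_fact0 lerDl sumr_ge0 // => i _.
exact: rising_fact_ge0.
Qed.

Lemma cvg_sum_ord N (f : 'I_N -> nat -> R) (l : 'I_N -> R) :
  (forall i, f i @ \oo --> l i) ->
  (fun n => \sum_(i < N) f i n) @ \oo --> \sum_(i < N) l i.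
Proof. by move=> fl; apply: cvg_big => //; exact: add_continuous. Qed.

(** A Toeplitz averaging argument: the weights are nonnegative with sum 1, and
    the weight of each fixed j tends to 0 with n because (x)_n / n! does. *)
Lemma beta_binomial_cvg x b (l : R) : 0 <= x <= 2^-1 ->
  b @ \oo --> l -> beta_binomial x b @ \oo --> l.
Proof.
move=> xI bl; have /andP[x0 x2] := xI; have x1 : 0 <= 1 - x by lra.
have w0 n j : 0 <= rising_fact (1 - x) j * rising_fact x (n - j).
  by rewrite mulr_ge0 ?rising_fact_ge0.
apply/cvgrPdist_le => e e0.
have e2 : 0 < e / 2 by lra.
have [K _ bK] := (cvgrPdist_le _ _).1 bl _ e2.
(* The terms j < K, where b is not yet close to l, have vanishing weight. *)
have head : (fun n => \sum_(j < K) `|l - b j| * rising_fact (1 - x) j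
    * rising_fact x (n - j)) @ \oo --> 0.
  rewrite [X in _ --> X](_ : 0 = \sum_(j < K) `|l - b j| * rising_fact (1 - x) j * 0).
    apply: cvg_sum_ord => j; apply: cvgMl_tmp.
    rewrite -(cvg_shiftn j).
    under eq_fun do rewrite addnK.
    exact: rising_fact_cvg0.
  by rewrite big1 // => j _; rewrite mulr0.
have [N _ headN] := (cvgrPdist_le _ _).1 head _ e2.
exists (maxn K N) => // n /=; rewrite geq_max => /andP[Kn Nn].
have -> : l - beta_binomial x b n = \sum_(j < n.+1)
    rising_fact (1 - x) j * rising_fact x (n - j) * (l - b j).
  rewrite -[l in LHS]mul1r -[X in X * l](beta_binomial1 x n) /beta_binomial mulr_suml -sumrB.
  by apply: eq_bigr => j _; ring.
apply: (le_trans (ler_norm_sum _ _ _)).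
apply: (@le_trans _ _ (\sum_(j < n.+1)
      (rising_fact (1 - x) j * rising_fact x (n - j) * (e / 2)) +
    \sum_(j < n.+1 | (j < K)%N)
      `|l - b j| * rising_fact (1 - x) j * rising_fact x (n - j))).
  rewrite [X in _ <= _ + X]big_mkcond /= -big_split /= ler_sum // => j _.
  rewrite normrM (ger0_norm (w0 _ _)); case: ltnP => jK.
    by rewrite mulrC [leLHS]mulrA lerDr mulr_ge0 // ltW.
  by rewrite addr0 ler_wpM2l // bK.
rewrite -mulr_suml; have := beta_binomial1 x n.
rewrite /beta_binomial; under eq_bigr do rewrite mulr1.
move=> ->; rewrite mul1r.
have -> : \sum_(j < n.+1 | (j < K)%N) `|l - b j| * rising_fact (1 - x) j
    * rising_fact x (n - j) = \sum_(j < K) `|l - b j| * rising_fact (1 - x) j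
    * rising_fact x (n - j).
  by rewrite (big_ord_widen n.+1 (fun j => `|l - b j| * rising_fact (1 - x) j
    * rising_fact x (n - j))) // ltnW.
have := headN n Nn; rewrite sub0r normrN ger0_norm; first lra.
by apply: sumr_ge0 => j _; rewrite -mulrA mulr_ge0.
Qed.

Lemma psum_transfer_cvg x a (l : R) : 0 <= x <= 2^-1 -> a 0 = 0 ->
  psum a @ \oo --> l -> psum (transfer x a) @ \oo --> l.
Proof.
move=> xI a0 al.
rewrite (_ : psum (transfer x a) = beta_binomial x (psum a)).
  exact: beta_binomial_cvg.
by apply/funext => n; rewrite beta_binomial_psum.
Qed.

Lemma transfer_ge0 x a : 0 <= x <= 2^-1 -> (forall n, 0 <= a n) ->
  forall n, 0 <= transfer x a n.
Proof.
move=> /andP[x0 x2] a0 n; have x1 : 0 <= 1 - x by lra.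
rewrite mulr_ge0 ?invr_ge0 // sumr_ge0 // => j _.
by rewrite !mulr_ge0 ?rising_fact_ge0.
Qed.

Lemma psum_ge0 a n : (forall n, 0 <= a n) -> 0 <= psum a n.
Proof. by move=> a0; apply: sumr_ge0. Qed.

(** The comparison sequence (x)_n / n! is, up to a constant, stable under Cesaro
    means, unlike 1/n; this replaces bounds by powers of log n. *)
Definition dominated x a :=
  exists C : R, forall n, 0 <= a n <= C * rising_fact x n.

Lemma dominated_coef x a C : (forall n, 0 <= a n <= C * rising_fact x n) -> 0 <= C.
Proof. by move=> /(_ 0%N)/andP[/le_trans h /h]; rewrite rising_fact0 mulr1. Qed.

Lemma dominated_cesaro x a : 0 < x <= 2^-1 ->
  dominated x a -> dominated x (cesaro_mean a).
Proof.
move=> /andP[x0 x2] [C aC]; have C0 := dominated_coef aC.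
have a0 n : 0 <= a n by case/andP: (aC n).
(* By [psum_rising_fact] the constant is (n + x) / (n x) <= 2 / x. *)
exists (C * (2 / x)) => -[|n].
  by rewrite /cesaro_mean invr0 mul0r lexx rising_fact0 mulr1 mulr_ge0 // divr_ge0 // ltW.
rewrite mulr_ge0 ?psum_ge0 //= /cesaro_mean.
have -> : C * (2 / x) * rising_fact x n.+1 =
    n.+1%:R^-1 * (C * ((n.+1%:R + n.+1%:R) * rising_fact x n.+1 / x)).
  by have := natS_neq0 R n; move: n.+1%:R => y y0; field; rewrite y0 gt_eqF.
rewrite ler_wpM2l ?invr_ge0 //.
apply: (@le_trans _ _ (C * psum (rising_fact x) n.+1)).
  by rewrite /psum mulr_sumr ler_sum // => j _; case/andP: (aC j).
rewrite ler_wpM2l // ler_pdivlMr // mulrC psum_rising_fact.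
rewrite ler_wpM2r ?rising_fact_ge0 ?(ltW x0) // lerD2l.
have : 1 <= n.+1%:R :> R by rewrite ler1n.
lra.
Qed.

Lemma shift_div_ge0 x a : 0 <= x <= 2^-1 -> (forall n, 0 <= a n) ->
  forall n, 0 <= shift_div x a n.
Proof.
move=> /andP[x0 x2] a0 [|n]; first by rewrite /shift_div invr0 !mul0r.
rewrite divr_ge0 ?mulr_ge0 ?invr_ge0 // subr_ge0 ler_pdivrMr ?ltr0Sn // mul1r.
have : 1 <= n.+1%:R :> R by rewrite ler1n.
lra.
Qed.

Lemma shift_div_le x a : 0 <= x <= 2^-1 -> (forall n, 0 <= a n) ->
  forall n, shift_div x a n <= 2 * (a n / n%:R).
Proof.
move=> /andP[x0 x2] a0 [|n]; first by rewrite /shift_div invr0 !(mul0r, mulr0).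
rewrite [a _ / _]mulrC /shift_div [leLHS]mulrC ler_wpM2r ?mulr_ge0 ?invr_ge0 //.
have n1 : 1 <= n.+1%:R :> R by rewrite ler1n.
have xn : x / n.+1%:R <= 2^-1 by rewrite ler_pdivrMr ?ltr0Sn //; lra.
move: (x / n.+1%:R) xn => y yn.
by rewrite -div1r ler_pdivrMr; lra.
Qed.

Lemma dominated_shift_div x a : 0 < x <= 2^-1 ->
  dominated x a -> dominated x (shift_div x a).
Proof.
move=> /andP[x0 x2] [C aC]; have xI : 0 <= x <= 2^-1 by rewrite ltW.
have a0 n : 0 <= a n by case/andP: (aC n).
exists (2 * C) => n; rewrite shift_div_ge0 //=.
apply: (le_trans (shift_div_le xI a0 n)).
rewrite -mulrA ler_wpM2l //; case/andP: (aC n) => _; apply: le_trans.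
case: n => [|n]; first by rewrite invr0 mulr0.
by rewrite ler_pdivrMr ?ltr0Sn // ler_peMr // ler1n.
Qed.

Lemma dominated_shift_div1 x : 0 < x <= 2^-1 ->
  dominated x (shift_div x (fun=> 1)).
Proof.
move=> /andP[x0 x2]; have xI : 0 <= x <= 2^-1 by rewrite ltW.
exists (2 / x) => n; rewrite shift_div_ge0 //=.
apply: (le_trans (shift_div_le xI _ n)) => //.
rewrite -mulrA ler_wpM2l //; case: n => [|n].
  by rewrite rising_fact0 invr0 mulr0 mulr1 invr_ge0 ltW.
rewrite mul1r mulrC ler_pdivlMr // mulrC ler_pdivrMr ?ltr0Sn // mulrC.
exact/rising_fact_lbound/ltW.
Qed.

Lemma psum_shift_div_bounded x a : 0 < x <= 2^-1 -> dominated x a ->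
  exists M : R, forall n, psum (shift_div x a) n <= M.
Proof.
move=> /andP[x0 x2] [C aC]; have xI : 0 <= x <= 2^-1 by rewrite ltW.
have C0 := dominated_coef aC.
have a0 n : 0 <= a n by case/andP: (aC n).
(* Each term is at most 4 C times a decrement of (x)_n / n!, which starts
   at 1. *)
exists (4 * C) => n.
apply: (@le_trans _ _ (4 * C * (1 - rising_fact x n))); last first.
  by rewrite ler_piMr ?mulr_ge0 // gerBl rising_fact_ge0 // ltW.
elim: n => [|n IH].
  by rewrite psum0 rising_fact0 subrr mulr0 /shift_div invr0 !mul0r.
rewrite psumS.
have -> : 4 * C * (1 - rising_fact x n.+1) = 4 * C * (1 - rising_fact x n)
   + 2 * C * (2 * (rising_fact x n - rising_fact x n.+1)) by ring.
rewrite lerD //; apply: (le_trans (shift_div_le xI a0 _)).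
rewrite -mulrA ler_wpM2l //.
apply: (@le_trans _ _ (C * (rising_fact x n.+1 / n.+1%:R))).
  by rewrite mulrA ler_wpM2r ?invr_ge0 //; case/andP: (aC n.+1).
by rewrite ler_wpM2l // rising_fact_decr.
Qed.

End Estimates.

(** * Power series with coefficients in sequences *)

Section FormalFamilies.
Variable R : realType.
Implicit Types (x : R) (f g : nat -> R) (a : nat -> nat -> R) (w : nat -> nat -> R).

(** A function of m and n stands for the formal power series in x whose m-th
    coefficient is a sequence indexed by n; operators act coefficientwise. *)
Definition lift_op (K : (nat -> R) -> nat -> R) a : nat -> nat -> R :=
  fun m => K (a m).

(** The formal power series (1 - x K)^-1 a. *)
Fixpoint resolvent (K : (nat -> R) -> nat -> R) a m : nat -> R :=
  if m is m'.+1 then fun n => a m n + K (resolvent K a m') n else a 0.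

Definition kernel_op w f n : R := \sum_(j < n.+1) w n j * f j.

(** Evaluation at x: the formal series [a] converges pointwise to [f]. *)
Definition generates x a f :=
  (forall m n, 0 <= a m n) /\
  forall n, series (fun m => a m n * x ^+ m) @ \oo --> f n.

Lemma ndiv_kernel : @ndiv R = kernel_op (fun n j => (j == n)%:R / n%:R).
Proof.
apply/funext => f; apply/funext => n.
rewrite /kernel_op big_ord_recr /= eqxx mul1r big1 ?add0r // => -[j /= jn] _.
by rewrite ltn_eqF // !mul0r.
Qed.

Lemma cesaro_kernel : @cesaro_mean R = kernel_op (fun n j => n%:R^-1).
Proof.
by apply/funext => f; apply/funext => n; rewrite /kernel_op -mulr_sumr.
Qed.

Lemma kernel_op_sum w M (c : nat -> R) a n :
  kernel_op w (fun j => \sum_(0 <= m < M) a m j * c m) n =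
  \sum_(0 <= m < M) kernel_op w (a m) n * c m.
Proof.
rewrite /kernel_op; under eq_bigr do rewrite mulr_sumr.
rewrite exchange_big; apply: eq_bigr => m _; rewrite mulr_suml.
by apply: eq_bigr => j _; rewrite mulrA.
Qed.

Lemma kernel_op_cvg w (F : nat -> nat -> R) f n :
  (forall j, F ^~ j @ \oo --> f j) ->
  (fun M => kernel_op w (F M) n) @ \oo --> kernel_op w f n.
Proof. by move=> Ff; apply: cvg_sum_ord => j; apply: cvgMl_tmp. Qed.

Lemma kernel_op_le w f g n : (forall i j, 0 <= w i j) ->
  (forall j, f j <= g j) -> kernel_op w f n <= kernel_op w g n.
Proof. by move=> w0 fg; apply: ler_sum => j _; apply: ler_wpM2l. Qed.

Lemma kernel_op_ge0 w f n : (forall i j, 0 <= w i j) ->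
  (forall j, 0 <= f j) -> 0 <= kernel_op w f n.
Proof. by move=> w0 f0; apply: sumr_ge0 => j _; apply: mulr_ge0. Qed.

Lemma generates_kernel x a f w : (forall i j, 0 <= w i j) ->
  generates x a f -> generates x (lift_op (kernel_op w) a) (kernel_op w f).
Proof.
move=> w0 [a0 af]; split=> [m n|n]; first exact: kernel_op_ge0.
have := @kernel_op_cvg w _ _ n af.
rewrite (_ : (fun M => _) = series (fun m => lift_op (kernel_op w) a m n * x ^+ m)) //.
by apply/funext => M; rewrite /series /= kernel_op_sum.
Qed.

Lemma resolvent_ge0 w a : (forall i j, 0 <= w i j) ->
  (forall m n, 0 <= a m n) -> forall m n, 0 <= resolvent (kernel_op w) a m n.
Proof.
move=> w0 a0; elim=> [|m IH] n //=.
by rewrite addr_ge0 // kernel_op_ge0.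
Qed.

(** K is lower triangular, so that [f = x K f] forces f to vanish as soon as the
    diagonal entries of x K avoid 1. *)
Lemma kernel_fixpoint0 x w f :
  (forall n, x * w n n != 1) ->
  (forall n, f n = x * kernel_op w f n) -> forall n, f n = 0.
Proof.
move=> xw ff n; elim/ltn_ind: n => n IH.
apply/eqP; have := ff n; rewrite /kernel_op big_ord_recr /= big1; last first.
  by move=> j _; rewrite IH ?mulr0.
rewrite add0r mulrA => /eqP; rewrite -subr_eq0 -{1}[f n]mul1r -mulrBl.
by rewrite mulf_eq0 subr_eq0 eq_sym (negPf (xw n)).
Qed.

(** The partial sums S of the resolvent satisfy [S_(M+1) = P_(M+1) + x K S_M]
    with P those of [a].  They increase and stay below any nonnegative solution
    [g] of [g = f + x K g]; their limit solves the same equation, whose solution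
    is unique. *)
Lemma generates_resolvent x a f g w :
  0 <= x -> (forall i j, 0 <= w i j) -> (forall n, x * w n n != 1) ->
  (forall n, 0 <= g n) -> (forall n, g n = f n + x * kernel_op w g n) ->
  generates x a f -> generates x (resolvent (kernel_op w) a) g.
Proof.
move=> x0 w0 xw g0 gf [a0 af]; have r0 := resolvent_ge0 w0 a0.
split=> // n.
pose S n := series (fun m => resolvent (kernel_op w) a m n * x ^+ m).
have SS n' M : S n' M.+1 =
    series (fun m => a m n' * x ^+ m) M.+1 + x * kernel_op w (S ^~ M) n'.
  rewrite /S /series /= kernel_op_sum !big_nat_recl //= -addrA; congr (_ + _).
  rewrite mulr_sumr -big_split; apply: eq_bigr => m _ /=.
  by rewrite exprS; ring.
have aS n' : nondecreasing_seq (series (fun m => a m n' * x ^+ m)).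
  by apply: nondecreasing_series => m _; rewrite mulr_ge0 ?exprn_ge0.
have Sg M n' : S n' M <= g n'.
  elim: M n' => [|M IH] n'; first by rewrite /S /series /= big_geq.
  rewrite SS gf lerD //; last by rewrite ler_wpM2l // kernel_op_le.
  rewrite -(cvg_lim _ (af n')) //.
  by apply: nondecreasing_cvgn_le => //; apply/cvg_ex; exists (f n').
have Sc n' : cvgn (S n').
  apply: nondecreasing_is_cvgn.
    by apply: nondecreasing_series => m _; rewrite mulr_ge0 ?exprn_ge0.
  by exists (g n') => _ [M _ <-].
pose s n := limn (S n).
have sE n' : s n' = f n' + x * kernel_op w s n'.
  apply/cvg_lim => //; rewrite -cvg_shiftS.
  rewrite (_ : [sequence S n' M.+1]_M = fun M =>
    series (fun m => a m n' * x ^+ m) M.+1 + x * kernel_op w (S ^~ M) n'); last first.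
    by apply/funext => M; exact: SS.
  apply: cvgD; first by rewrite (cvg_shiftS (series _)).
  by apply: cvgMl_tmp; apply: kernel_op_cvg.
suff <- : s n = g n by apply: Sc.
apply/eqP; rewrite -subr_eq0; apply/eqP; move: n.
apply: (@kernel_fixpoint0 x w) => // n.
rewrite [in LHS]sE [in LHS]gf opprD addrACA subrr add0r -mulrBr.
by congr (_ * _); rewrite /kernel_op -sumrB; apply: eq_bigr => j _; rewrite mulrBr.
Qed.

End FormalFamilies.

(** * Duality of indices and sums over exponents *)

Lemma foldr_nseq (S T : Type) (f : S -> T -> T) (a : T) n c :
  foldr f a (nseq n c) = iter n (f c) a.
Proof. by elim: n => //= n ->. Qed.

(** In the word of an index, an entry c stands for one letter Y followed by c - 1
    letters X.  The dual index has the reversed word with X and Y exchanged, and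
    on a single block (a, b) both sides are [X^a Y^b]. *)
Lemma foldr_rev_dual (T : Type) (X Y : T -> T) a k : admissible k ->
  foldr (fun c t => iter c.-1 X (Y t)) a (rev (dual_index k)) =
  foldr (fun c t => X (iter c.-1 Y t)) a k.
Proof.
move=> kA; have kI : is_index k by case/andP: kA.
rewrite -[in RHS](blocksK kA) /dual_index.
elim: (blocks k) (blocks_pos kI) => [|[p q] s IH] //= /andP[/andP[p0 q0] sP].
rewrite /of_blocks rev_cons map_rcons flatten_rcons rev_cat rev_rcons rev_nseq.
rewrite /= !foldr_cat -cats1 foldr_cat !foldr_nseq /= IH //.
have iterS1 m (Z : T -> T) t : (0 < m)%N -> Z (iter m.-1 Z t) = iter m Z t.
  by case: m.
by rewrite iterS1 // -iterSr (prednK p0).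
Qed.

Lemma dual_blocks_pos k : is_index k ->
  all (fun p => (0 < p.1) && (0 < p.2))%N (rev [seq (p.2, p.1) | p <- blocks k]).
Proof.
by move=> /blocks_pos; rewrite all_rev all_map; apply: sub_all => p /=; rewrite andbC.
Qed.

Lemma dual_admissible k : admissible k -> admissible (dual_index k).
Proof. by case/andP => kI _; exact: (of_blocksK (dual_blocks_pos kI)).1. Qed.

Lemma dual_indexK k : admissible k -> dual_index (dual_index k) = k.
Proof.
move=> kA; have kI : is_index k by case/andP: kA.
rewrite {1}/dual_index (of_blocksK (dual_blocks_pos kI)).2.
rewrite map_rev revK -map_comp (@eq_map _ _ _ id) ?map_id ?blocksK //.
by case.
Qed.

Lemma size_oplus k e : size e = size k -> size (oplus k e) = size k.
Proof. by move=> ek; rewrite size_map size_zip ek minnn. Qed.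

Lemma rev_oplus k e : size k = size e -> rev (oplus k e) = oplus (rev k) (rev e).
Proof. by move=> ke; rewrite /oplus -map_rev rev_zip. Qed.

Lemma oplus_is_index k e : size e = size k -> is_index k -> is_index (oplus k e).
Proof.
elim: k e => [|c k IH] [|i e] //= [ek] /andP[c0 kI].
by rewrite addn_gt0 c0 IH.
Qed.

Lemma oplus_admissible k e : size e = size k -> admissible k -> admissible (oplus k e).
Proof.
rewrite /admissible => ek /andP[kI kl]; rewrite oplus_is_index //=.
elim/last_ind: k e ek kl {kI} => [|k c _] e; first by case: e.
case/lastP: e => [|e i]; first by rewrite size_rcons.
rewrite !size_rcons => -[ek]; rewrite /oplus zip_rcons // map_rcons !last_rcons /=.
by move=> /leq_trans -> //; rewrite leq_addr.
Qed.

(** The coefficient c_1 read from the last entry, so as to follow the recursion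
    on the reversed index; the Kronecker delta sits at the end of the list. *)
Fixpoint c1_rev (k e : seq nat) : nat :=
  match k, e with
  | c :: k', i :: e' => 'C(c + i + (k' == [::]) - 2, i) * c1_rev k' e'
  | _, _ => 1
  end.

Lemma c1_revE k e : size e = size k -> c1 k e = c1_rev (rev k) (rev e).
Proof.
elim/last_ind: k e => [|k c IH] e.
  by case: e => // _; rewrite /c1 /dep big_ord0.
case/lastP: e => [|e i]; rewrite !size_rcons // => -[ek].
rewrite !rev_rcons /= -IH // /c1 /dep size_rcons big_ord_recr mulnC /=.
congr muln.
  apply: eq_bigr => -[j jk] _ /=.
  by rewrite !nth_rcons ek jk.
by rewrite !nth_rcons ek ltnn eqxx -[rev k == _]size_eq0 size_rev.
Qed.

Section CompositionSums.
Variable V : nmodType.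
Implicit Types F G : seq nat -> V.

(** Recursive form of a sum over the exponents of length [r] and weight [m], from
    which one entry at a time can be split off; see [tuple_csum]. *)
Fixpoint csum r m F : V :=
  if r is r'.+1 then \sum_(i < m.+1) csum r' (m - i)%N (fun s => F (nat_of_ord i :: s))
  else if m == 0%N then F [::] else 0.

Lemma eq_csum r m F G : (forall s, size s = r -> F s = G s) ->
  csum r m F = csum r m G.
Proof.
elim: r m F G => [|r IH] m F G FG /=; first by rewrite FG.
by apply: eq_bigr => i _; apply: IH => s sr; rewrite FG //= sr.
Qed.

Lemma tuple_csum M r m F : (m < M)%N ->
  \sum_(e : r.-tuple 'I_M | sumn (map val e) == m) F (map val e) = csum r m F.
Proof.
elim: r m F => [|r IH] m F mM /=.
  rewrite big_mkcond (big_pred1 [tuple]) /=; first by rewrite eq_sym.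
  by move=> t; apply/esym/eqP; exact: tuple0.
rewrite (reindex (fun p : 'I_M * r.-tuple 'I_M => [tuple of p.1 :: p.2])) /=; last first.
  exists (fun t => (thead t, [tuple of behead t])) => [[i t] _|t _] /=.
    by rewrite theadE; congr (_, _); apply: val_inj.
  by rewrite -tuple_eta.
under eq_bigl do rewrite -[_ == _]andTb.
rewrite -(pair_big_dep xpredT (fun i t => val i + sumn (map val (tval t)) == m)%N
  (fun i t => F (val i :: map val (tval t)))) /=.
rewrite (big_ord_widen_cond M xpredT (fun i => csum r (m - i)%N (fun s => F (i :: s)))) //=.
rewrite [RHS]big_mkcond; apply: eq_bigr => i _; case: ifPn => im.
  rewrite -IH; last by rewrite (leq_ltn_trans (leq_subr _ _)).
  by apply: eq_bigl => t; rewrite ltnS in im; rewrite -[in LHS](subnKC im) eqn_add2l.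
rewrite big_pred0 // => t; apply: contraNF im => /eqP <-.
by rewrite ltnS leq_addr.
Qed.

Lemma tuple_csum_rev M r m F : (m < M)%N ->
  \sum_(e : r.-tuple 'I_M | sumn (map val e) == m) F (map val e) =
  csum r m (fun s => F (rev s)).
Proof.
move=> mM; rewrite -(tuple_csum _ _ mM).
rewrite (reindex_inj (h := fun t : r.-tuple 'I_M => [tuple of rev t])) /=; last first.
  by move=> s t /(congr1 val) /= /(can_inj (@revK _)) /val_inj.
apply: eq_big => t; first by rewrite map_rev sumn_rev.
by rewrite map_rev.
Qed.

Lemma csum_sum r m N (F : seq nat -> 'I_N -> V) :
  csum r m (fun s => \sum_(j < N) F s j) = \sum_(j < N) csum r m (F ^~ j).
Proof.
elim: r m F => [|r IH] m F /=; first by case: eqP => // _; rewrite big1.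
by rewrite exchange_big; apply: eq_bigr => i _ /=; rewrite IH.
Qed.
End CompositionSums.

Lemma csumZ (R : pzSemiRingType) r m (c : R) F :
  csum r m (fun s => c * F s) = c * csum r m F.
Proof.
elim: r m F => [|r IH] m F /=; first by case: eqP => //; rewrite mulr0.
by rewrite mulr_sumr; apply: eq_bigr => i _; rewrite IH.
Qed.

(** * The formal generating families *)

Section Families.
Variable R : realType.
Implicit Types (x : R) (f g : nat -> R) (a : nat -> nat -> R).

Definition delta n : R := (n == 0%N)%:R.

(** For the reversed index [k], the summand of the zeta-star value once all
    variables but the largest are summed out. *)
Definition star_vec (k : seq nat) : nat -> R :=
  foldr (fun c f => iter c.-1 (@ndiv R) (cesaro_mean f)) delta k.

(** The formal counterpart of [shift_div]:
    1 / (n - x) = (1 - x / n)^-1 * 1/n. *)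
Definition fshift a := resolvent (@ndiv R) (lift_op (@ndiv R) a).
(** The letter D preceded by an arbitrary number of letters A, counted by x. *)
Definition finsert a := lift_op (@ndiv R) (resolvent (@cesaro_mean R) a).

Definition const_family f : nat -> nat -> R :=
  fun m n => if m == 0%N then f n else 0.

Fixpoint left_family (k : seq nat) : nat -> nat -> R :=
  if k is c :: k' then
    iter c.-1 fshift (if k' is [::] then fshift (const_family (fun=> 1))
                      else lift_op (@cesaro_mean R) (left_family k'))
  else const_family delta.

Definition right_family (k : seq nat) :=
  foldr (fun c a => iter c.-1 finsert (lift_op (@cesaro_mean R) a))
    (const_family delta) k.

Lemma iter_ndiv p f n : iter p (@ndiv R) f n = n%:R^-1 ^+ p * f n.
Proof.
elim: p => [|p IH]; first by rewrite expr0 mul1r.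
by rewrite iterS /ndiv IH exprS mulrA.
Qed.

Lemma fshift0 a n : fshift a 0 n = n%:R^-1 * a 0%N n.
Proof. by []. Qed.

Lemma fshiftS a m n :
  fshift a m.+1 n = n%:R^-1 * a m.+1 n + n%:R^-1 * fshift a m n.
Proof. by []. Qed.

(** The negative binomial series for (n - x)^(-p); for p = 0 the truncated
    coefficients reduce to the term e = 0. *)
Lemma iter_fshift p a m n : iter p fshift a m n =
  \sum_(e < m.+1) 'C(p + e - 1, e)%:R * n%:R^-1 ^+ (p + e) * a (m - e)%N n.
Proof.
elim: p m => [|p IH] m.
  rewrite big_ord_recl big1 ?addr0; first by rewrite subn0 bin0 expr0 !mul1r.
  by move=> i _; rewrite lift0 add0n subn1 bin_small // !mul0r.
rewrite iterS; elim: m => [|m IHm].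
  rewrite fshift0 IH !big_ord1 /= !addn0 !bin0 !mul1r exprS.
  by rewrite mulrA.
rewrite fshiftS IHm IH.
rewrite !mulr_sumr big_ord_recl [RHS]big_ord_recl /= -addrA; congr (_ + _).
  by rewrite !addn0 !bin0 exprS; ring.
rewrite -big_split; apply: eq_bigr => -[i im] _ /=.
have -> : bump 0 i = i.+1 by [].
have -> : (p + i.+1 - 1 = p + i)%N by lia.
have -> : (p.+1 + i - 1 = p + i)%N by lia.
have -> : (p.+1 + i.+1 - 1 = (p + i).+1)%N by lia.
rewrite subSS !addSn addnS binS natrD !exprS.
ring.
Qed.

Lemma csum_iter_cesaro r m p (F : seq nat -> nat -> R) n :
  csum r m (fun s => iter p (@cesaro_mean R) (F s) n) =
  iter p (@cesaro_mean R) (fun j => csum r m (F ^~ j)) n.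
Proof.
elim: p n => [|p IH] n //=.
rewrite /cesaro_mean csumZ csum_sum; congr (_ * _).
by apply: eq_bigr => j _; rewrite IH.
Qed.

(** The innermost letter of [left_family] is [fshift] where the others are Cesaro
    means: this accounts for the Kronecker delta of c_1. *)
Lemma left_family_csum k m n : is_index k -> k != [::] ->
  left_family k m n =
  csum (size k) m (fun e => (c1_rev k e)%:R * star_vec (oplus k e) n).
Proof.
elim: k m n => [//|c k IH] m n /= /andP[c0 kI] _.
have [->|k0] := eqVneq k [::].
  rewrite -iterSr (prednK c0) iter_fshift /=.
  apply: eq_bigr => -[i im] _ /=.
  rewrite /const_family; case: eqP => [_|]; last by rewrite mulr0.
  have ci : (c + i).-1 = (c.-1 + i)%N by lia.
  rewrite ci iter_ndiv /cesaro_mean /psum big_ord_recl big1 ?addr0 //.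
  rewrite (_ : delta _ = 1) // muln1.
  have -> : (c + i + 1 - 2 = c + i - 1)%N by lia.
  have -> : (c + i = (c.-1 + i).+1)%N by lia.
  by rewrite exprS; ring.
have -> : (if k is [::] then fshift (const_family (fun=> 1))
    else lift_op (@cesaro_mean R) (left_family k)) =
  lift_op (@cesaro_mean R) (left_family k) by case: (k) k0.
rewrite iter_fshift; apply: eq_bigr => -[i im] _ /=.
have -> : lift_op (@cesaro_mean R) (left_family k) (m - i)%N n =
  csum (size k) (m - i)%N (fun e => cesaro_mean
    (fun j => (c1_rev k e)%:R * star_vec (oplus k e) j) n).
  rewrite [RHS](csum_iter_cesaro _ _ 1
    (fun e j => (c1_rev k e)%:R * star_vec (oplus k e) j)) /=.
  by congr cesaro_mean; apply/funext => j; rewrite IH.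
rewrite -csumZ; apply: eq_csum => s ss.
have ci : (c + i).-1 = (c.-1 + i)%N by lia.
rewrite addn0 ci iter_ndiv /cesaro_mean /psum -mulr_sumr natrM.
have -> : (c.-1 + i - 1)%N = (c + i - 2)%N by lia.
ring.
Qed.

Lemma resolvent_cesaro a m n : resolvent (@cesaro_mean R) a m n =
  \sum_(e < m.+1) iter e (@cesaro_mean R) (a (m - e)%N) n.
Proof.
elim: m n => [|m IH] n /=; first by rewrite big_ord1.
rewrite [RHS]big_ord_recl /=; congr (_ + _).
rewrite /cesaro_mean /psum; under [X in _ * X]eq_bigr do rewrite IH.
by rewrite exchange_big mulr_sumr.
Qed.

(** By duality an entry of the dual index contributes the letter D after powers
    of A, and adding e_i to it adds e_i letters A. *)
Lemma right_family_csum k m n : admissible k ->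
  right_family (rev k) m n =
  csum (size (dual_index k)) m
    (fun e => star_vec (rev (dual_index (oplus (dual_index k) e))) n).
Proof.
move=> kA; have dA := dual_admissible kA.
transitivity (csum (size (dual_index k)) m (fun e =>
  foldr (fun c f => ndiv (iter c.-1 (@cesaro_mean R) f)) delta
    (oplus (dual_index k) e) n)); last first.
  apply: eq_csum => e ek.
  by rewrite /star_vec foldr_rev_dual // oplus_admissible.
rewrite /right_family -[X in rev X](dual_indexK kA) foldr_rev_dual //.
have : is_index (dual_index k) by case/andP: dA.
elim: (dual_index k) m n => [|c l IH] m n //= /andP[c0 lI].
rewrite {1}/finsert /lift_op {1}/ndiv resolvent_cesaro mulr_sumr.
apply: eq_bigr => -[i im] _ /=.
rewrite csumZ csum_iter_cesaro; congr (_ * _).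
have -> : (c + i).-1 = (i + c.-1)%N by lia.
rewrite iterD; congr (iter _ _ _ _).
transitivity (iter c.-1 (@cesaro_mean R)
  (foldr (fun c0 t => finsert (iter c0.-1 (fun a m => cesaro_mean (a m)) t))
     (const_family delta) l (m - i)%N)).
  by elim: (c.-1) => //= p ->.
congr iter; apply/funext => j; exact: IH.
Qed.
End Families.

(** * Evaluation of the generating families *)

Section Generation.
Variable R : realType.
Implicit Types (x : R) (f g : nat -> R) (a : nat -> nat -> R).

(** The value at x of the generating function of the left-hand side, as a
    function of the largest summation variable; the index is reversed. *)
Fixpoint shifted_vec x (k : seq nat) : nat -> R :=
  if k is c :: k' then
    iter c.-1 (shift_div x) (if k' is [::] then shift_div x (fun=> 1)
                             else cesaro_mean (shifted_vec x k'))
  else @delta R.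

Lemma iter_ind (T : Type) (P : T -> Prop) (h : T -> T) p t :
  (forall u, P u -> P (h u)) -> P t -> P (iter p h t).
Proof. by move=> Ph Pt; elim: p => //= p; exact: Ph. Qed.

Lemma shifted_vec_ind x (P : (nat -> R) -> Prop) k :
  P (shift_div x (fun=> 1)) ->
  (forall f, P f -> P (shift_div x f)) -> (forall f, P f -> P (cesaro_mean f)) ->
  k != [::] -> P (shifted_vec x k).
Proof.
move=> P1 Pd Pc; elim: k => [//|c k IH] _ /=; apply: iter_ind => //.
by case: (k) IH => // d l IH; apply: Pc; apply: IH.
Qed.

Lemma shifted_vec0 x k : k != [::] -> shifted_vec x k 0 = 0.
Proof.
apply: (@shifted_vec_ind x (fun f => f 0%N = 0)) => [|f _|f _].
- by rewrite /shift_div invr0 !mul0r.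
- by rewrite /shift_div invr0 !mul0r.
- by rewrite /cesaro_mean invr0 mul0r.
Qed.

Lemma dominated_shifted_vec x k : 0 < x <= 2^-1 -> k != [::] ->
  dominated x (shifted_vec x k).
Proof.
move=> xI; apply: shifted_vec_ind.
- exact: dominated_shift_div1.
- by move=> f; exact: dominated_shift_div.
- by move=> f; exact: dominated_cesaro.
Qed.

Lemma shifted_vec_ge0 x k : 0 < x <= 2^-1 -> k != [::] ->
  forall n, 0 <= shifted_vec x k n.
Proof.
by move=> xI k0 n; have [C /(_ n)/andP[]] := dominated_shifted_vec xI k0.
Qed.

Lemma dominated_iter x p f : 0 < x <= 2^-1 -> dominated x f ->
  dominated x (iter p (shift_div x) f).
Proof. by move=> xI; apply: iter_ind => g; exact: dominated_shift_div. Qed.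

(** The outermost letter is [shift_div] since the last entry of an admissible
    index exceeds 1. *)
Lemma shifted_vec_summable x k : 0 < x <= 2^-1 -> k != [::] -> (1 < head 0 k)%N ->
  cvgn (psum (shifted_vec x k)).
Proof.
move=> xI k0 hk; have sv0 := shifted_vec_ge0 xI k0.
have [M HM] : exists M : R, forall n, psum (shifted_vec x k) n <= M.
  case: k hk {k0 sv0} => [|[|[|c]] k] //= _.
  apply: psum_shift_div_bounded => //; apply: dominated_iter => //.
  case: k => [|d k]; first exact: dominated_shift_div1.
  by apply: dominated_cesaro => //; exact: dominated_shifted_vec.
apply: nondecreasing_is_cvgn; last by exists M => _ [n _ <-].
by apply/nondecreasing_seqP => n; rewrite psumS lerDl.
Qed.

Lemma natr_neq_small x n : 0 < x <= 2^-1 -> (0 < n)%N -> n%:R != x.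
Proof.
move=> /andP[x0 x2] n0; rewrite gt_eqF //.
have : 1 <= n%:R :> R by rewrite ler1n.
lra.
Qed.

Lemma small_div_neq1 x n : 0 < x <= 2^-1 -> x * n%:R^-1 != 1.
Proof.
move=> xI; case: n => [|n]; first by rewrite invr0 mulr0 eq_sym oner_neq0.
apply: contra_neq (natr_neq_small xI (ltn0Sn n)) => e.
by have := canRL (divfK (natS_neq0 R n)) e; rewrite mul1r.
Qed.

Lemma generates_fshift x a f : 0 < x <= 2^-1 -> (forall n, 0 <= f n) ->
  generates x a f -> generates x (fshift a) (shift_div x f).
Proof.
move=> xI f0 af; have [x0 x2] := andP xI; have xI' : 0 <= x <= 2^-1 by rewrite ltW.
rewrite /fshift ndiv_kernel; have w0 i j : 0 <= (j == i)%:R / i%:R :> R.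
  by rewrite divr_ge0.
apply: (generates_resolvent (f := kernel_op (fun n j => (j == n)%:R / n%:R) f)).
- exact: ltW.
- exact: w0.
- by move=> n; rewrite eqxx mul1r small_div_neq1.
- exact: shift_div_ge0.
- rewrite -ndiv_kernel => -[|n]; first by rewrite /shift_div /ndiv invr0 !mul0r mulr0 addr0.
  have := natS_neq0 R n; have := natr_neq_small xI (ltn0Sn n).
  rewrite /shift_div /ndiv -subr_eq0; move: n.+1%:R (f n.+1) => y t yx y0.
  by field; rewrite yx y0.
- exact: generates_kernel.
Qed.

Lemma generates_cesaro x a f : generates x a f ->
  generates x (lift_op (@cesaro_mean R) a) (cesaro_mean f).
Proof.
by move=> af; rewrite cesaro_kernel; apply: generates_kernel => // i j; rewrite invr_ge0.
Qed.

(** By [transfer_resolvent] the sequence n T D_x f (n) solves the fixpoint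
    equation that defines the resolvent of the Cesaro mean at T f. *)
Lemma generates_finsert x a f : 0 < x <= 2^-1 -> (forall n, 0 <= f n) ->
  generates x a (transfer x f) ->
  generates x (finsert a) (transfer x (shift_div x f)).
Proof.
move=> xI f0 af; have [x0 x2] := andP xI; have xI' : 0 <= x <= 2^-1 by rewrite ltW.
rewrite (_ : transfer x (shift_div x f) =
    ndiv (fun n => n%:R * transfer x (shift_div x f) n)); last first.
  by apply/funext => n; rewrite ndivK_transfer.
rewrite /finsert ndiv_kernel; apply: generates_kernel.
  by move=> i j; rewrite divr_ge0.
rewrite cesaro_kernel.
apply: (generates_resolvent _ _ _ _ _ af).
- exact: ltW.
- by move=> i j; rewrite invr_ge0.
- by move=> n; exact: small_div_neq1.
- by move=> n; rewrite mulr_ge0 // transfer_ge0 // => j; exact: shift_div_ge0.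
- move=> n; rewrite -cesaro_kernel; apply: transfer_resolvent => j.
  exact: natr_neq_small.
Qed.

Lemma generates_const x f : (forall n, 0 <= f n) -> generates x (const_family f) f.
Proof.
move=> f0; split=> [m n|n]; first by rewrite /const_family; case: ifP.
rewrite -(cvg_shiftn 1) (_ : [sequence _]_n = fun=> f n); first exact: cvg_cst.
apply/funext => M; rewrite /series /= addn1 big_nat_recl //.
by rewrite big1 ?addr0 ?mulr1 // => m _; rewrite mul0r.
Qed.

Lemma generates_left_family x k : 0 < x <= 2^-1 -> k != [::] ->
  generates x (left_family R k) (shifted_vec x k).
Proof.
move=> xI; elim: k => [//|c k IH] _ /=.
have base : generates x
    (if k is [::] then fshift (const_family (fun=> 1))
     else lift_op (@cesaro_mean R) (left_family R k))
    (if k is [::] then shift_div x (fun=> 1) else cesaro_mean (shifted_vec x k)).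
  case: (k) IH => [_|d l IH]; last by apply: generates_cesaro; apply: IH.
  by apply: generates_fshift => //; exact: generates_const.
elim: (c.-1) => //= p; apply: generates_fshift => //.
exact: (shifted_vec_ge0 (k := p.+1 :: k)).
Qed.

(** Letter by letter, T carries [shifted_vec] to the value of the generating
    function of the right-hand side. *)
Lemma generates_right_family x k : 0 < x <= 2^-1 -> k != [::] ->
  generates x (right_family R k) (transfer x (shifted_vec x k)).
Proof.
move=> xI; elim: k => [//|c k IH] _ /=.
have base : generates x (lift_op (@cesaro_mean R) (right_family R k))
    (transfer x (if k is [::] then shift_div x (fun=> 1)
                 else cesaro_mean (shifted_vec x k))).
  case: (k) IH => [_|d l IH].
    rewrite (_ : transfer x _ = cesaro_mean (@delta R)).
      by apply: generates_cesaro; apply: generates_const => n; rewrite ler0n.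
    apply/funext => n; rewrite transfer_shift_one; last by move=> j; exact: natr_neq_small.
    by rewrite /cesaro_mean /psum big_ord_recl big1 ?addr0 ?mulr1.
  rewrite (_ : transfer x _ = cesaro_mean (transfer x (shifted_vec x (d :: l)))).
    by apply: generates_cesaro; apply: IH.
  by apply/funext => n; rewrite transfer_cesaro // shifted_vec0.
elim: (c.-1) => //= p; apply: generates_finsert => //.
exact: (shifted_vec_ge0 (k := p.+1 :: k)).
Qed.

End Generation.

(** * Zeta-star values as series *)

Section StarSeries.
Variable R : realType.

Lemma esumZl_ge0 (T : choiceType) (S : set T) (c : R) (a : T -> \bar R) :
  0 <= c -> (forall t, 0 <= a t)%E ->
  (\esum_(t in S) (c%:E * a t) = c%:E * \esum_(t in S) a t)%E.
Proof.
have half (d : R) (b : T -> \bar R) : 0 <= d -> (forall t, 0 <= b t)%E ->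
    (\esum_(t in S) (d%:E * b t) <= d%:E * \esum_(t in S) b t)%E.
  move=> d0 b0; apply: ge_ereal_sup => _ [F SF <-].
  rewrite -ge0_mule_fsumr // lee_wpmul2l ?lee_fin //.
  by apply: ereal_sup_ubound; exists F.
rewrite le_eqVlt => /orP[/eqP<- _|c0 a0].
  by rewrite mul0e esum1 // => t _; rewrite mul0e.
have ca0 t : (0 <= c%:E * a t)%E by rewrite mule_ge0 // lee_fin ltW.
apply/eqP; rewrite eq_le (half _ _ (ltW c0) a0) /=.
rewrite -lee_pdivlMl //.
have := half c^-1 (fun t => c%:E * a t)%E _ ca0.
rewrite invr_ge0 => /(_ (ltW c0)); apply: le_trans.
apply: le_esum => t _; rewrite muleA -EFinM mulVf ?mul1e //.
by rewrite gt_eqF.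
Qed.

Definition star_term (k n : seq nat) : R :=
  \prod_(i < dep k) ((nth 0%N n i)%:R ^+ nth 0%N k i)^-1.

Lemma star_term_ge0 k n : 0 <= star_term k n.
Proof. by apply: prodr_ge0 => i _; rewrite invr_ge0 exprn_ge0. Qed.

Lemma star_term_rcons k n c j : size n = size k ->
  star_term (rcons k c) (rcons n j) = (j%:R ^+ c)^-1 * star_term k n.
Proof.
move=> nk; rewrite /star_term /dep size_rcons big_ord_recr /= mulrC.
rewrite !nth_rcons nk ltnn eqxx; congr (_ * _).
by apply: eq_bigr => -[i ik] _ /=; rewrite !nth_rcons nk ik.
Qed.

Definition star_domain (r : nat) : set (seq nat) :=
  [set n | [&& size n == r, all (fun x => 0 < x)%N n & sorted leq n]].

Definition star_domain_le (r N : nat) : set (seq nat) :=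
  star_domain r `&` [set n | all (fun x => x <= N)%N n].

Lemma sorted_rcons_leq n j :
  sorted leq (rcons n j) = sorted leq n && all (fun x => x <= j)%N n.
Proof.
rewrite -cats1 /sorted; elim: n => [//|x n IH] /=.
case: n IH => [|y n] /= => [_|->]; first by rewrite andbT.
apply/idP/idP => [/and3P[xy -> /andP[yj ->]]|/and3P[/andP[xy ->] xj /andP[-> ->]]].
  by rewrite xy yj (leq_trans xy).
by rewrite xy.
Qed.

Lemma star_domain_rcons r (J : set nat) : (forall j, J j -> (0 < j)%N) ->
  star_domain r.+1 `&` [set n | J (last 0%N n)] =
  (fun p => rcons p.2 p.1) @` (J `*`` star_domain_le r).
Proof.
move=> J0; apply/seteqP; split=> n /=.
  case=> /and3P[]; case/lastP: n => [//|n j].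
  rewrite size_rcons eqSS all_rcons sorted_rcons_leq last_rcons.
  move=> nr /andP[j0 n0] /andP[ns nj] Jj.
  by exists (j, n) => //; split=> //; split=> //=; apply/and3P.
case=> -[j n'] /= [Jj [/and3P[nr n0 ns] nj]] <-; split; last by rewrite last_rcons.
by rewrite /star_domain /= size_rcons eqSS nr all_rcons J0 //= n0 sorted_rcons_leq ns.
Qed.

(** Splits off the largest summation variable j. *)
Lemma esum_star_term_rcons k c (J : set nat) : (forall j, J j -> (0 < j)%N) ->
  (\esum_(n in star_domain (size k).+1 `&` [set n | J (last 0%N n)])
    (star_term (rcons k c) n)%:E =
  \esum_(j in J) ((j%:R ^+ c)^-1%:E *
    \esum_(n in star_domain_le (size k) j) (star_term k n)%:E))%E.
Proof.
move=> J0; rewrite star_domain_rcons // esum_image; last first.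
  move=> [j n] [j' n'] _ _ /= /eqP.
  by rewrite eqseq_rcons => /andP[/eqP-> /eqP->].
rewrite -(esum_esum (a := fun j n => (star_term (rcons k c) (rcons n j))%:E)); last first.
  by move=> *; rewrite lee_fin star_term_ge0.
apply: eq_esum => j Jj; rewrite -esumZl_ge0; first last.
- by move=> n; rewrite lee_fin star_term_ge0.
- by rewrite invr_ge0 exprn_ge0.
apply: eq_esum => n [/and3P[/eqP nk _ _] _].
by rewrite -EFinM star_term_rcons.
Qed.

Lemma star_vec_cons c k j : (0 < c)%N ->
  star_vec R (c :: k) j = (j%:R ^+ c)^-1 * psum (star_vec R k) j.
Proof.
case: c => // c _; rewrite /star_vec /= iter_ndiv /cesaro_mean mulrA -exprSr.
by rewrite exprVn.
Qed.

Lemma star_vec_ge0 k j : is_index k -> 0 <= star_vec R k j.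
Proof.
elim: k j => [|c k IH] j /=; first by rewrite ler0n.
move=> /andP[c0 kI]; rewrite [X in 0 <= X]star_vec_cons // mulr_ge0 ?invr_ge0 ?exprn_ge0 //.
by apply: sumr_ge0 => i _; apply: IH.
Qed.

Lemma esum_star_domain_le k N : is_index k ->
  (\esum_(n in star_domain_le (size k) N) (star_term (rev k) n)%:E =
   (psum (star_vec R k) N)%:E)%E.
Proof.
elim: k N => [|c k IH] N.
  move=> _; rewrite (_ : star_domain_le _ N = [set [::]]); last first.
    by apply/seteqP; split=> [n [/and3P[/eqP/size0nil]]|n ->].
  rewrite esum_set1 ?lee_fin ?star_term_ge0 // /star_term big_ord0.
  by rewrite /psum big_ord_recl big1 ?addr0.
move=> /andP[c0 kI]; rewrite rev_cons.
pose J := [set j | (0 < j <= N)%N].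
have -> : star_domain_le (size (c :: k)) N =
    star_domain (size (rev k)).+1 `&` [set n | J (last 0%N n)].
  rewrite size_rev; apply/seteqP; split=> n /= [nd].
    case/lastP: n nd => [|n j] nd; first by case/and3P: nd.
    rewrite /= all_rcons last_rcons /J /= => /andP[jN _]; split=> //.
    by case/and3P: nd => _; rewrite all_rcons jN => /andP[->].
  case/lastP: n nd => [|n j] nd; first by case/and3P: nd.
  rewrite last_rcons => /andP[_ jN]; split=> //=; rewrite all_rcons jN /=.
  case/and3P: nd => _ _; rewrite sorted_rcons_leq => /andP[_].
  by apply: sub_all => x /leq_trans; apply.
rewrite esum_star_term_rcons ?size_rev; last by move=> j /andP[].
transitivity (\esum_(j in `I_N.+1) (star_vec R (c :: k) j)%:E)%E.
  rewrite (_ : J = `I_N.+1 `&` [set j | (0 < j)%N]); last first.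
    by apply/seteqP; split=> j; rewrite /J /= ltnS; [case/andP | case=> -> ->].
  rewrite esum_mkcondr; apply: eq_esum => -[|j] jN.
    by rewrite memNset // star_vec_cons // expr0n gtn_eqF // invr0 mul0r.
  by rewrite mem_set // IH // -EFinM star_vec_cons.
rewrite esum_fset //; last first.
  by move=> j _; rewrite lee_fin star_vec_ge0 //= c0.
by rewrite -fsbig_ord sumEFin.
Qed.

(** Iterating the splitting of the largest variable produces the operators of
    [star_vec]. *)
Lemma zeta_star_series k : is_index k -> k != [::] ->
  zeta_star R k = fine (\sum_(j <oo) (star_vec R (rev k) j)%:E)%E.
Proof.
move=> kI k0; congr fine.
rewrite -[k in LHS]revK; have : rev k != [::] by rewrite -size_eq0 size_rev size_eq0.
have : is_index (rev k) by rewrite /is_index all_rev.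
case: (rev k) => // c l /andP[c0 lI] _; rewrite rev_cons.
have -> : [set n : seq nat | [&& size n == dep (rcons (rev l) c),
    all (fun x => (0 < x)%N) n & sorted leq n]] =
    star_domain (size (rev l)).+1 `&` [set n | (0 < last 0%N n)%N].
  rewrite /dep size_rcons; apply/seteqP; split=> n /=; last by case.
  move=> nP; split=> //; case/lastP: n nP => [|n j] /and3P[] //.
  by rewrite last_rcons all_rcons => _ /andP[].
rewrite [LHS](esum_star_term_rcons _ _ (J := [set j | (0 < j)%N])) //.
rewrite nneseries_esumT; last by move=> j; rewrite lee_fin star_vec_ge0 //= c0.
rewrite -[X in esum X _](@setTI _ [set j | _]) esum_mkcondr size_rev.
apply: eq_esum => -[|j] _.
  by rewrite memNset // star_vec_cons // expr0n gtn_eqF // invr0 mul0r.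
by rewrite mem_set // esum_star_domain_le // -EFinM star_vec_cons.
Qed.

End StarSeries.

(** * Uniqueness of power series with nonnegative coefficients *)

Section PowerSeries.
Variable R : realType.
Implicit Types (f g : nat -> \bar R).
Local Open Scope ereal_scope.

Lemma nneseries_pow_fin_num f (x : R) m : (0 < x)%R -> (forall i, 0 <= f i) ->
  \sum_(i <oo) f i * (x ^+ i)%:E < +oo -> f m \is a fin_num.
Proof.
move=> x0 f0 ffin.
have t0 i : 0 <= f i * (x ^+ i)%:E by rewrite mule_ge0 // lee_fin exprn_ge0 // ltW.
have fm : f m * (x ^+ m)%:E < +oo.
  apply: le_lt_trans ffin; rewrite (nneseriesD1 (n := m)) //.
  rewrite leeDl //; apply: nneseries_ge0 => i _ _; exact: t0.
rewrite ge0_fin_numE //; move: fm (f0 m); case: (f m) => [r|//|//] //=.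
  by move=> _ _; rewrite ltry.
by rewrite gt0_mulye // lte_fin exprn_gt0.
Qed.

End PowerSeries.

(** If d_m is the first nonzero coefficient, the tail of the series is at most
    C x^(m+1), so that |d_m| <= C x for all small x. *)
Lemma power_series_coef_eq (R : realType) (d : nat -> R) (r : R) : 0 < r ->
  (forall x, 0 < x <= r -> series (fun i => d i * x ^+ i) @ \oo --> 0) ->
  (exists M : R, forall N, series (fun i => `|d i| * r ^+ i) N <= M) ->
  forall m, d m = 0.
Proof.
move=> r0 dx [M HM] m; elim/ltn_ind: m => m IH.
have Mle N : \sum_(0 <= i < N) `|d i| * r ^+ i <= M := HM N.
pose C := M / r ^+ m.+1.
have key x : 0 < x <= r -> `|d m| <= C * x.
  move=> xr; have /andP[x0 xr'] := xr.
  suff h e : 0 < e -> `|d m| * x ^+ m <= x ^+ m.+1 * C + e.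
    have : `|d m| * x ^+ m <= x ^+ m.+1 * C.
      by apply/ler_addgt0Pr => e; exact: h.
    by rewrite exprS mulrAC ler_pM2r ?exprn_gt0 // mulrC.
  move=> e0; have [N _ HN] := (cvgrPdist_le _ _).1 (dx _ xr) _ e0.
  have := HN (m.+1 + N)%N (leq_addl _ _); rewrite sub0r normrN /series /=.
  rewrite (big_cat_nat (n := m.+1)) ?leq_addr //= big_nat_recr //= big_nat big1 ?add0r; last first.
    by move=> i /andP[_ im]; rewrite IH // mul0r.
  set tail := \sum_(_ <= i < _) _ => HT.
  have tailC : `|tail| <= x ^+ m.+1 * C.
    rewrite /C mulrCA; apply: (le_trans (ler_norm_sum _ _ _)).
    apply: (@le_trans _ _ (\sum_(m.+1 <= i < m.+1 + N)
        (x ^+ m.+1 / r ^+ m.+1) * (`|d i| * r ^+ i))).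
      rewrite !big_nat; apply: ler_sum => i /andP[mi _].
      rewrite normrM [`|x ^+ i|]ger0_norm ?exprn_ge0 ?(ltW x0) // [leRHS]mulrCA ler_wpM2l //.
      rewrite -(subnK mi) !(exprD _ (i - m.+1)) [r ^+ _ * _]mulrC mulrA.
      rewrite divfK ?expf_neq0 ?gt_eqF // mulrC ler_wpM2l ?exprn_ge0 ?(ltW x0) //.
      by rewrite lerXn2r ?nnegrE ?(ltW x0) ?(ltW r0).
    rewrite -mulr_sumr mulrC ler_wpM2r ?divr_ge0 ?exprn_ge0 ?(ltW x0) ?(ltW r0) //.
    apply: le_trans (Mle (m.+1 + N)%N).
    rewrite [leRHS](big_cat_nat (n := m.+1)) ?leq_addr //= lerDr.
    by apply: sumr_ge0 => i _; rewrite mulr_ge0 ?exprn_ge0 // ltW.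
  have : `|d m * x ^+ m| <= `|d m * x ^+ m + tail| + `|tail|.
    by rewrite -{1}(addrK tail (d m * x ^+ m)) (le_trans (ler_normB _ _)).
  rewrite normrM [`|x ^+ m|]ger0_norm ?exprn_ge0 ?(ltW x0) //.
  by move=> h; apply: (le_trans h); rewrite addrC lerD.
have C0 : 0 <= C.
  have := key r; rewrite r0 lexx => /(_ isT) h.
  by rewrite -(pmulr_lge0 _ r0) (le_trans _ h).
apply/eqP; rewrite -normr_eq0 eq_le normr_ge0 andbT.
apply/ler_addgt0Pr => e e0; rewrite add0r.
have C1 : 0 < C + 1 by lra.
have [er|re] := leP (e / (C + 1)) r.
  have := key (e / (C + 1)); rewrite divr_gt0 // er => /(_ isT) h; apply: (le_trans h).
  by rewrite mulrCA ger_pMr // ler_pdivrMr // mul1r lerDl.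
have := key r; rewrite r0 lexx => /(_ isT) h; apply: (le_trans h).
move: re; rewrite ltr_pdivlMr //; nra.
Qed.

Lemma nneseries_cvg (R : realType) (a : nat -> R) : (forall i, 0 <= a i) ->
  (\sum_(i <oo) (a i)%:E < +oo)%E ->
  series a @ \oo --> fine (\sum_(i <oo) (a i)%:E)%E.
Proof.
move=> a0 afin.
have c := @is_cvg_nneseries R (fun i => (a i)%:E) xpredT 0 (fun i _ _ => a0 i).
rewrite (_ : series a = fine \o (fun n => \sum_(0 <= i < n) (a i)%:E)%E); last first.
  by apply/funext => n /=; rewrite sumEFin.
apply: fine_cvg; rewrite fineK //.
rewrite ge0_fin_numE //; apply: nneseries_ge0 => i _ _; exact: a0.
Qed.

Lemma cvg_nneseries (R : realType) (a : nat -> R) (l : R) :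
  series a @ \oo --> l -> (\sum_(i <oo) (a i)%:E = l%:E)%E.
Proof.
move=> al; apply/cvg_lim => //.
rewrite (_ : (fun n => _) = EFin \o series a); last first.
  by apply/funext => n /=; rewrite sumEFin.
by apply: cvg_EFin => //; apply: nearW.
Qed.

(** Finiteness of the coefficients is part of the conclusion: it is how the
    convergence of all the zeta-star values is obtained. *)
Lemma nneseries_pow_eq (R : realType) (f g : nat -> \bar R) (r : R) : 0 < r ->
  (forall i, 0 <= f i)%E -> (forall i, 0 <= g i)%E ->
  (forall x, 0 < x <= r -> (\sum_(i <oo) f i * (x ^+ i)%:E < +oo)%E) ->
  (forall x, 0 < x <= r ->
    (\sum_(i <oo) f i * (x ^+ i)%:E = \sum_(i <oo) g i * (x ^+ i)%:E)%E) ->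
  forall m, (f m \is a fin_num) /\ f m = g m.
Proof.
move=> r0 f0 g0 ffin fg m.
have rr : 0 < r <= r by rewrite r0 lexx.
have ff i : f i \is a fin_num by apply: (nneseries_pow_fin_num i r0) => //; exact: ffin.
have gf i : g i \is a fin_num.
  by apply: (nneseries_pow_fin_num i r0) => //; rewrite -fg //; exact: ffin.
split=> //; rewrite -[LHS]fineK // -[RHS]fineK //; congr _%:E.
apply/eqP; rewrite -subr_eq0; apply/eqP.
have fE (h : nat -> \bar R) x : (forall i, h i \is a fin_num) ->
    (\sum_(i <oo) h i * (x ^+ i)%:E = \sum_(i <oo) (fine (h i) * x ^+ i)%:E)%E.
  move=> hf; congr (limn _); apply/funext => n.
  by apply: eq_bigr => i _; rewrite EFinM fineK.
have t0 (h : nat -> \bar R) x i : 0 < x <= r -> (forall i, 0 <= h i)%E ->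
    0 <= fine (h i) * x ^+ i.
  by move=> /andP[x0 _] h0; rewrite mulr_ge0 ?fine_ge0 ?exprn_ge0 // ltW.
have cf x : 0 < x <= r -> series (fun i => fine (f i) * x ^+ i) @ \oo -->
    fine (\sum_(i <oo) f i * (x ^+ i)%:E)%E.
  move=> xr; rewrite fE //; apply: nneseries_cvg; first by move=> i; exact: t0.
  by rewrite -fE //; exact: ffin.
have cg x : 0 < x <= r -> series (fun i => fine (g i) * x ^+ i) @ \oo -->
    fine (\sum_(i <oo) g i * (x ^+ i)%:E)%E.
  move=> xr; rewrite fE //; apply: nneseries_cvg; first by move=> i; exact: t0.
  by rewrite -fE // -fg //; exact: ffin.
apply: (@power_series_coef_eq _ (fun i => fine (f i) - fine (g i)) r r0) => [x xr|].
  rewrite (_ : series _ = series (fun i => fine (f i) * x ^+ i) \-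
    series (fun i => fine (g i) * x ^+ i)); last first.
    by apply/funext => N; rewrite /series /= -sumrB; apply: eq_bigr => i _; rewrite mulrBl.
  have := cvgB (cf x xr) (cg x xr).
  by rewrite -fg // subrr => /(_ _); exact.
exists (fine (\sum_(i <oo) f i * (r ^+ i)%:E)%E +
  fine (\sum_(i <oo) g i * (r ^+ i)%:E)%E) => N.
apply: (@le_trans _ _ (series (fun i => fine (f i) * r ^+ i) N +
    series (fun i => fine (g i) * r ^+ i) N)).
  rewrite /series /= -big_split /= ler_sum // => i _; rewrite -mulrDl.
  rewrite ler_wpM2r ?exprn_ge0 ?(ltW r0) // (le_trans (ler_normB _ _)) //.
  by rewrite !ger0_norm ?fine_ge0.
rewrite lerD //.
  rewrite -(cvg_lim _ (cf r rr)) // nondecreasing_cvgn_le //; last exact: cvgP (cf r rr).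
  by apply: nondecreasing_series => i _ _; exact: t0.
rewrite -(cvg_lim _ (cg r rr)) // nondecreasing_cvgn_le //; last exact: cvgP (cg r rr).
by apply: nondecreasing_series => i _ _; exact: t0.
Qed.

(** * The generating functions and their coefficients *)

Section Total.
Variable R : realType.
Implicit Types (x : R) (f : nat -> R) (a : nat -> nat -> R).

Lemma psum_cvg_series f (l : R) : psum f @ \oo --> l -> series f @ \oo --> l.
Proof.
rewrite -[series f @ \oo --> l]cvg_shiftS; congr (_ @ \oo --> l).
by apply/funext => n; rewrite /psum /series /= big_mkord.
Qed.

(** Tonelli: the order of the summations over the exponent of x and over n is
    exchanged. *)
Lemma generates_nneseries x a f (l : R) : 0 < x -> generates x a f ->
  psum f @ \oo --> l ->
  (\sum_(m <oo) (\sum_(n <oo) (a m n)%:E) * (x ^+ m)%:E = l%:E)%E.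
Proof.
move=> x0 [a0 af] fl.
have t0 m n : (0 <= (a m n * x ^+ m)%:E)%E.
  by rewrite lee_fin mulr_ge0 ?exprn_ge0 // ltW.
transitivity (\sum_(m <oo) \sum_(n <oo) (a m n * x ^+ m)%:E)%E.
  congr (limn _); apply/funext => N; apply: eq_bigr => m _.
  rewrite muleC -nneseriesZl; last by move=> n _; rewrite lee_fin.
  congr (limn _); apply/funext => M; apply: eq_bigr => n _.
  by rewrite muleC.
rewrite nneseries_interchange // -(cvg_nneseries (psum_cvg_series fl)).
congr (limn _); apply/funext => N; apply: eq_bigr => n _.
exact: cvg_nneseries.
Qed.

(** A term with [c e = 0] contributes 0 even if its series diverges; the others
    are finite because the total is. *)
Lemma fine_nneseries_sum (I : finType) (P : pred I) (c : I -> R)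
    (z : I -> nat -> R) :
  (forall e, 0 <= c e) -> (forall e n, P e -> 0 <= z e n) ->
  (\sum_(n <oo) (\sum_(e | P e) c e * z e n)%R%:E)%E \is a fin_num ->
  \sum_(e | P e) c e * fine (\sum_(n <oo) (z e n)%:E)%E =
  fine (\sum_(n <oo) (\sum_(e | P e) c e * z e n)%R%:E)%E.
Proof.
move=> c0 z0.
have -> : (\sum_(n <oo) (\sum_(e | P e) c e * z e n)%R%:E =
    \sum_(e | P e) (c e)%:E * \sum_(n <oo) (z e n)%:E)%E.
  transitivity (\sum_(n <oo) \sum_(e | P e) (c e * z e n)%:E)%E.
    by congr (limn _); apply/funext => N; apply: eq_bigr => n _; rewrite sumEFin.
  rewrite nneseries_sum; last by move=> e n Pe; rewrite lee_fin mulr_ge0 // z0.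
  apply: eq_bigr => e Pe; rewrite -nneseriesZl //.
  by move=> n _; rewrite lee_fin z0.
move=> /sum_fin_numP zfin.
rewrite -sum_fine; last by move=> e Pe; apply: zfin => //; exact: mem_index_enum.
apply: eq_bigr => e Pe; have := zfin e (mem_index_enum e) Pe.
have [->|ce] := eqVneq (c e) 0; first by rewrite !mul0e mul0r.
have : (0 < (c e)%:E)%E by rewrite lte_fin lt_neqAle eq_sym ce c0.
case: (\sum_(n <oo) _)%E => [r|ce0|ce0] //.
  by rewrite gt0_muley.
by rewrite gt0_muleNy.
Qed.

Lemma zeta_star_sum_nonempty (k : seq nat) (m : nat) : admissible k -> k != [::] ->
  \sum_(e : (dep k).-tuple 'I_m.+1 | wt (map val e) == m)
     (c1 k (map val e))%:R * zeta_star R (oplus k (map val e)) =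
  \sum_(e : (dep (dual_index k)).-tuple 'I_m.+1 | wt (map val e) == m)
     zeta_star R (dual_index (oplus (dual_index k) (map val e))).
Proof.
move=> kA k0; have /andP[kI kl] := kA; have dA := dual_admissible kA.
have rk0 : rev k != [::] by rewrite -size_eq0 size_rev size_eq0.
have rkI : is_index (rev k) by rewrite /is_index all_rev.
have d0 : dual_index k != [::].
  by apply: contra_neq k0 => dk; rewrite -(dual_indexK kA) dk.
have hk : (1 < head 0 (rev k))%N.
  by case/lastP: k kl k0 {kA kI dA rk0 rkI d0} => // s c; rewrite last_rcons rev_rcons.
have half0 : 0 < 2^-1 :> R by rewrite invr_gt0.
pose F i := (\sum_(n <oo) (left_family R (rev k) i n)%:E)%E.
pose G i := (\sum_(n <oo) (right_family R (rev k) i n)%:E)%E.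
have rr : 0 < (2^-1 : R) <= 2^-1 by rewrite half0 lexx.
have F0 i : (0 <= F i)%E.
  apply: nneseries_ge0 => n _ _; rewrite lee_fin.
  by have [] := generates_left_family rr rk0.
have G0 i : (0 <= G i)%E.
  apply: nneseries_ge0 => n _ _; rewrite lee_fin.
  by have [] := generates_right_family rr rk0.
have FG x : 0 < x <= 2^-1 -> exists l : R,
   (\sum_(i <oo) F i * (x ^+ i)%:E = l%:E /\
    \sum_(i <oo) G i * (x ^+ i)%:E = l%:E)%E.
  move=> xI; have [x0 x2] := andP xI.
  have cv := shifted_vec_summable xI rk0 hk.
  exists (limn (psum (shifted_vec x (rev k)))); split.
    exact: (generates_nneseries x0 (generates_left_family xI rk0)).
  apply: (generates_nneseries x0 (generates_right_family xI rk0)).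
  by apply: psum_transfer_cvg => //; rewrite ?(ltW x0) ?shifted_vec0.
have [Ffin FGm] := nneseries_pow_eq half0 F0 G0
  (fun x xI => let: ex_intro l (conj e _) := FG x xI in
     eq_ind_r (fun t => (t < +oo)%E) (ltry l) e)
  (fun x xI => let: ex_intro l (conj e e') := FG x xI in etrans e (esym e')) m.
have sz r (e : r.-tuple 'I_m.+1) : size (map val e) = r by rewrite size_map size_tuple.
transitivity (fine (F m)).
  have FE : F m = (\sum_(n <oo)
      (\sum_(e : (dep k).-tuple 'I_m.+1 | wt (map val e) == m)
        (c1 k (map val e))%:R * star_vec R (rev (oplus k (map val e))) n)%R
      %:E)%E.
    congr (limn _); apply/funext => N; apply: eq_bigr => n _; congr _%:E.
    rewrite left_family_csum // size_rev.
    rewrite (tuple_csum_rev (M := m.+1) (size k)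
      (fun s => (c1 k s)%:R * star_vec R (rev (oplus k s)) n)) //.
    apply: eq_csum => s ss; rewrite c1_revE ?size_rev // revK.
    by rewrite rev_oplus ?size_rev // revK.
  rewrite FE -fine_nneseries_sum -?FE //; last first.
    move=> e n _; apply: star_vec_ge0; rewrite /is_index all_rev.
    exact: (oplus_is_index (sz _ e)).
  apply: eq_bigr => e _; rewrite zeta_star_series //.
    exact: (oplus_is_index (sz _ e)).
  by rewrite -size_eq0 (size_oplus (sz _ e)) size_eq0.
rewrite FGm.
have GE : G m = (\sum_(n <oo)
    (\sum_(e : (dep (dual_index k)).-tuple 'I_m.+1 | wt (map val e) == m)
      1 * star_vec R (rev (dual_index (oplus (dual_index k) (map val e)))) n)%R
    %:E)%E.
  congr (limn _); apply/funext => N; apply: eq_bigr => n _; congr _%:E.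
  rewrite right_family_csum //.
  rewrite -(tuple_csum (M := m.+1) (size (dual_index k))
    (fun s => star_vec R (rev (dual_index (oplus (dual_index k) s))) n)) //.
  by apply: eq_bigr => e _; rewrite mul1r.
have eA (e : (dep (dual_index k)).-tuple 'I_m.+1) :
    admissible (dual_index (oplus (dual_index k) (map val e))).
  by apply: dual_admissible; apply: oplus_admissible => //; exact: sz.
rewrite GE -fine_nneseries_sum; last first.
- by rewrite -GE -FGm.
- by move=> e n _; apply: star_vec_ge0; rewrite /is_index all_rev; case/andP: (eA e).
- by [].
apply: eq_bigr => e _; rewrite mul1r zeta_star_series //.
  by case/andP: (eA e).
apply: contra_neq d0 => e0.
have : dual_index (dual_index (oplus (dual_index k) (map val e))) = [::] by rewrite e0.
rewrite dual_indexK ?oplus_admissible ?sz // => /(congr1 size)/eqP.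
by rewrite (size_oplus (sz _ e)) size_eq0 => /eqP.
Qed.
End Total.

Unset Implicit Arguments.

(* A sequence of r nonnegative integers of weight m is an r-tuple over
   'I_m.+1 = {0, ..., m} whose entries add up to m. *)
Theorem theorem1p5 (R : realType) (k : seq nat) (m : nat) :
  admissible k ->
  \sum_(e : (dep k).-tuple 'I_m.+1 | wt (map val e) == m)
     (c1 k (map val e))%:R * zeta_star R (oplus k (map val e)) =
  \sum_(e : (dep (dual_index k)).-tuple 'I_m.+1 | wt (map val e) == m)
     zeta_star R (dual_index (oplus (dual_index k) (map val e))).
Proof.
have [-> _|k0 kA] := eqVneq k [::]; last exact: zeta_star_sum_nonempty.
by apply: eq_bigr => e _; rewrite (tuple0 e) /c1 big_ord0 mul1r.
Qed.
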